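(* Let $n=2^k\cdot p_1^{k_1}\cdots p_l^{k_l}$ be a positive integer with the prime factor decomposition displayed ($p_1,\ldots,p_l$ pairwise distinct odd primes), such that $k\geq0$, $l\geq0$ and $k_1,\ldots,k_l\geq1$. Let $\tau:\mathbb{N}^+\rightarrow\mathbb{N}^+$ denote the divisor number function and let $\delta_{[k\leq 2]}:=1$ if $k\leq 2$ and $\delta_{[k\leq 2]}:=0$ otherwise. Then the number of isomorphism types of state spaces of endomorphisms of $\mathbb{Z}/n\mathbb{Z}$ is precisely $$\max\{2^{k\cdot\delta_{[k\leq 2]}},3k-3\}\cdot\prod_{i=1}^l k_i(\tau(p_i-1)+1).$$ Of these, precisely $$\max\{1,k\}\cdot\prod_{i=1}^l k_i$$ are $1$-trees, and precisely $$\max\{1,k,2k-3\}\cdot\prod_{i=1}^l k_i\tau(p_i-1)$$ are disjoint unions of cycles.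
   Context: $\mathbb{N}^+$ is the set of positive integers; $\tau(m)$ is the number of positive divisors of $m$. Empty products equal $1$. For a group endomorphism $\varphi$ of a finite group $G$, the state space $\Gamma_\varphi$ is the digraph with vertex set $G$ having a directed edge from $x$ to $y$ if and only if $y=\varphi(x)$ (loops allowed). Isomorphism types of state spaces are isomorphism classes of digraphs. A $1$-tree here is a state space that is weakly connected (equivalently, it contains exactly one directed cycle). Disjoint unions of cycles are disjoint unions of directed cycles, where cycles of length $1$ (a vertex with a loop) are allowed. *)

(* Defs.v *)
From mathcomp Require Import all_boot all_fingroup all_algebra.

Set Implicit Arguments.
Unset Strict Implicit.
Unset Printing Implicit Defensive.

Section Digraphs.

Variable V : finType.

(* A digraph on V is its set of arcs, loops allowed. *)
Definition digraph := {set V * V}.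

(* All the digraphs to be compared have the same vertex set V, so the
   bijections between vertex sets are the permutations of V. *)
Definition isomorphic (D E : digraph) : bool :=
  [exists h : {perm V}, forall x, forall y,
     ((x, y) \in D) == ((h x, h y) \in E)].

Lemma isomorphic_refl D : isomorphic D D.
Proof.
by apply/existsP; exists 1%g; apply/forallP=> x; apply/forallP=> y; rewrite !perm1.
Qed.

Lemma isomorphic_sym D E : isomorphic D E -> isomorphic E D.
Proof.
move=> /existsP[h /forallP hP]; apply/existsP; exists h^-1%g.
apply/forallP=> x; apply/forallP=> y.
by move: (hP (h^-1 x)%g) => /forallP/(_ (h^-1 y)%g); rewrite !permKV eq_sym.
Qed.

Lemma isomorphic_trans D E F :
  isomorphic D E -> isomorphic E F -> isomorphic D F.
Proof.
move=> /existsP[h /forallP hP] /existsP[g /forallP gP].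
apply/existsP; exists (h * g)%g; apply/forallP=> x; apply/forallP=> y.
rewrite !permM (eqP (forallP (hP x) y)); exact: (forallP (gP (h x)) (h y)).
Qed.

Definition isotype (D : digraph) : {set digraph} := [set E | isomorphic D E].

Lemma isotype_eq D E : (isotype D == isotype E) = isomorphic D E.
Proof.
apply/eqP/idP => [eqDE | isoDE].
  by have := isomorphic_refl E; rewrite -[isomorphic E E]in_set -/(isotype E) -eqDE inE.
apply/setP=> F; rewrite !inE; apply/idP/idP; apply: isomorphic_trans => //.
exact: isomorphic_sym.
Qed.

Definition isotypes (S : {set digraph}) : {set {set digraph}} :=
  [set isotype D | D in S].

Definition weakly_connected (D : digraph) : bool :=
  [forall x, forall y,
     connect [rel u v | ((u, v) \in D) || ((v, u) \in D)] x y].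

(* The subdigraph induced on B is a directed cycle visiting the vertices of B
   in the cyclic order c; for B = [set x] this is a loop, as next [:: x] x = x. *)
Definition induces_cycle (D : digraph) (B : {set V}) : bool :=
  [exists c : #|B|.-tuple V,
    [&& uniq c, B == [set x in c]
      & [forall x in B, forall y in B, ((x, y) \in D) == (y == next c x)]]].

Definition disjoint_union_of_cycles (D : digraph) : bool :=
  [exists P : {set {set V}},
    [&& partition P [set: V],
        [forall B in P, induces_cycle D B]
      & [forall x, forall y, ((x, y) \in D) ==> (pblock P x == pblock P y)]]].

End Digraphs.

Section StateSpaces.

Variable gT : finGroupType.

Definition endomorphisms : {set {ffun gT -> gT}} :=
  [set phi : {ffun gT -> gT} | morphic [set: gT] phi].

Definition state_space (phi : {ffun gT -> gT}) : digraph gT :=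
  [set xy : gT * gT | xy.2 == phi xy.1].

Definition state_spaces : {set digraph gT} :=
  [set state_space phi | phi in endomorphisms].

Definition one_trees : {set digraph gT} :=
  [set D in state_spaces | weakly_connected D].

Definition cycle_unions : {set digraph gT} :=
  [set D in state_spaces | disjoint_union_of_cycles D].

End StateSpaces.

(* The additive group of integers modulo n, for n > 0. The library's 'Z_n
   cannot be used here, because 'Z_1 has two elements. *)
Definition Zmod (n : nat) : finGroupType := 'I_n.-1.+1.

Definition tau (m : nat) : nat := size (divisors m).

Definition delta_le2 (k : nat) : nat := if k <= 2 then 1 else 0.

(* Main.v *)
Require Import Defs.
From mathcomp Require Import all_boot all_fingroup all_algebra.
From mathcomp Require Import cyclic zify.

Set Implicit Arguments.
Unset Strict Implicit.
Unset Printing Implicit Defensive.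

(** The endomorphisms of Z/n are the multiplications by a fixed [a], so the
    question is when multiplication by [a] and by [b] have isomorphic state
    spaces.  The number of fixed points of [x |-> a ^ m x] is
    gcd (a ^ m - 1, n), and the number of pairs of points with the same image
    is n gcd (a, n).  An isomorphism preserves both, hence it preserves, for
    each divisor [d] of [n], the truth of d | a and of a ^ m = 1 modulo d; this
    is the relation [same_congruences].

    Conversely this relation is enough for an isomorphism
    ([same_congruences_iso]).  It makes the two multiplications agree on their
    kernel, on their image and on which powers fix which points, and two
    commuting group endomorphisms [f], [g] with that property are conjugate
    ([conjugate_commuting_endomorphisms]).  On the subgroup where the
    decreasing images f^i(G) become stationary both are permutations giving
    each point the same period, so their cycles can be matched.  The conjugacy
    then extends step by step to larger and larger images, since the
    number of preimages of a point inside f^i(G) is determined by which images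
    contain the point and by the kernels, and these agree.

    It remains to count the classes of [same_congruences].  By the Chinese
    remainder theorem the counts are multiplicative over coprime moduli
    ([has_class_count_mul]), also when restricted to nilpotent multipliers
    (state space weakly connected) or to invertible ones (state space a union
    of cycles), because both conditions can be tested modulo each factor.

    Modulo a prime power p^e a multiplier is nilpotent or invertible.  The
    class of a nilpotent one is its p-adic valuation, cut off at e, which gives
    e classes.  For an invertible one with p odd, let [d] be the order of [a]
    modulo p; by lifting the exponent the class is determined by [d] and the
    valuation of a^d - 1 cut off at e, and each pair of a divisor of p - 1 and
    a valuation between 1 and e occurs: e tau(p - 1) classes.  For p = 2 lifting
    the exponent works only for bases that are 1 modulo 4, so the classes with
    a = 1 modulo 4 are sorted by the valuation of a - 1, and those with a = 3
    modulo 4 by the valuation of a^2 - 1, that is of a + 1; there, if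
    k > 2, the last two values k - 1 and k of the cut-off valuation of a + 1
    merge, as a^2 = 1 modulo 2^k in both cases. *)

(** * Conjugacy of commuting endomorphisms *)

(** Elements with the same label are matched by their ranks in the enumerations
    of the two fibres over that label. *)
Lemma matching_of_equal_fibres (T : finType) (C : eqType) (A B : {set T})
    (u v : T -> C) :
  (forall c, #|[set x in A | u x == c]| = #|[set y in B | v y == c]|) ->
  exists h : T -> T,
    {in A &, injective h} /\ {in A, forall x, (h x \in B) && (v (h x) == u x)}.
Proof.
move=> eq_fibres.
pose EA x := enum [set y in A | u y == u x].
pose EB x := enum [set y in B | v y == u x].
pose h x := nth x (EB x) (index x (EA x)).
have mem_EA x : x \in A -> x \in EA x by move=> Ax; rewrite mem_enum inE Ax /=.
have lt_idx x : x \in A -> index x (EA x) < size (EB x).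
  by move=> Ax; rewrite -cardE -eq_fibres cardE index_mem mem_EA.
have hP : {in A, forall x, (h x \in B) && (v (h x) == u x)}.
  move=> x Ax; have : h x \in EB x by rewrite mem_nth ?lt_idx.
  by rewrite mem_enum inE.
exists h; split=> // x y Ax Ay eq_h.
have eq_u : u x = u y.
  by case/andP: (hP x Ax) => _ /eqP <-; case/andP: (hP y Ay) => _ /eqP <-; rewrite eq_h.
have eq_EA : EA x = EA y by rewrite /EA eq_u.
have eq_EB : EB x = EB y by rewrite /EB eq_u.
have := lt_idx x Ax => ltx; have := lt_idx y Ay => lty.
move/eqP: eq_h; rewrite /h (set_nth_default y) // -eq_EB in lty *.
rewrite nth_uniq ?enum_uniq // -eq_EA => /eqP eq_idx.
by rewrite -(nth_index x (mem_EA x Ax)) eq_idx nth_index // eq_EA mem_EA.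
Qed.

Lemma iter_order_min (T : finType) (f : T -> T) x m :
  0 < m < fingraph.order f x -> iter m f x != x.
Proof.
case/andP=> m_gt0 lt_m; apply/eqP=> fmx.
by have := findex_iter lt_m; rewrite fmx findex0 => m0; rewrite -m0 in m_gt0.
Qed.

Lemma eq_order_of_eq_periods (T : finType) (f g : T -> T) x :
  injective f -> injective g ->
  (forall m, (iter m f x == x) = (iter m g x == x)) ->
  fingraph.order f x = fingraph.order g x.
Proof.
move=> f_inj g_inj eq_per.
have [lt_fg | lt_gf | //] := ltngtP (fingraph.order f x) (fingraph.order g x).
  have := @iter_order_min _ g x (fingraph.order f x).
  by rewrite fingraph.order_gt0 lt_fg -eq_per iter_order // eqxx => /(_ isT).
have := @iter_order_min _ f x (fingraph.order g x).
by rewrite fingraph.order_gt0 lt_gf eq_per iter_order // eqxx => /(_ isT).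
Qed.

(** The points of order [d] split into orbits with [d] points, each with one
    root.  So the number of cycles of length [d] depends only on the number of
    points of order [d]. *)
Lemma card_froots_of_order (T : finType) (f : T -> T) d :
  injective f -> 0 < d ->
  #|[set x | froots f x & fingraph.order f x == d]| * d
    = #|[set x | fingraph.order f x == d]|.
Proof.
move=> f_inj d_gt0; have sym_f := fconnect_sym f_inj.
pose a := [pred x | fingraph.order f x == d].
have sub_a : a \subset order_set f d by apply/subsetP=> x; rewrite !inE.
have cl_a : fclosed f a.
  apply: intro_closed => // x y /eqP <-; rewrite !inE => /eqP <-.
  by apply/eqP; apply: eq_card => z; rewrite -!topredE /= -(same_connect1 sym_f (eqxx _)).
have <- : fcard f a * d = #|[set x | fingraph.order f x == d]|.
  by rewrite (fcard_order_set f_inj sub_a cl_a); apply: eq_card => x; rewrite !inE.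
by congr (_ * _); apply: eq_card => x; rewrite !inE.
Qed.

(** Roots of [f]-cycles are matched with roots of [g]-cycles of the same length,
    and [f ^ i (root)] is sent to [g ^ i (image of the root)]. *)
Lemma conjugate_of_equal_periods (T : finType) (f g : T -> T) :
  injective f -> injective g ->
  (forall x m, (iter m f x == x) = (iter m g x == x)) ->
  exists2 h : T -> T, injective h & forall x, h (f x) = g (h x).
Proof.
move=> f_inj g_inj eq_per.
have sym_f := fconnect_sym f_inj; have sym_g := fconnect_sym g_inj.
have eq_ord x : fingraph.order f x = fingraph.order g x by apply: eq_order_of_eq_periods.
have [|s [s_inj sP]] := @matching_of_equal_fibres T _
    [set x | froots f x] [set x | froots g x] (fingraph.order f) (fingraph.order g).
  case=> [|d].
    by rewrite !eq_card0 // => x; rewrite !inE eqn0Ngt fingraph.order_gt0 andbF.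
  apply/eqP; rewrite -(eqn_pmul2r (ltn0Sn d)).
  have E (k : T -> T) : [set x in [set x | froots k x] | fingraph.order k x == d.+1]
           = [set x | froots k x & fingraph.order k x == d.+1].
    by apply/setP=> x; rewrite !inE.
  rewrite !E !card_froots_of_order //; apply/eqP.
  by apply: eq_card => x; rewrite !inE eq_ord.
pose r x := froot f x.
have rP x : r x \in [set x | froots f x] by rewrite inE /r roots_root.
have r_x x : fconnect f (r x) x by rewrite sym_f connect_root.
pose h x := iter (findex f (r x) x) g (s (r x)).
have ord_s x : fingraph.order g (s (r x)) = fingraph.order f (r x).
  by have /andP[_ /eqP] := sP _ (rP x).
have root_s x : froot g (s (r x)) = s (r x).
  by have := sP _ (rP x); rewrite inE => /andP[/eqP].
exists h => [x y eq_h|x].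
  have eq_s : s (r x) = s (r y).
    rewrite -root_s -[RHS]root_s.
    rewrite (fingraph.rootP sym_g (fconnect_iter g (findex f (r x) x) (s (r x)))).
    rewrite -/(h x) eq_h.
    exact/esym/(fingraph.rootP sym_g)/fconnect_iter.
  have eq_r : r x = r y by apply: s_inj.
  suffices eq_i : findex f (r x) x = findex f (r y) y.
    by rewrite -(iter_findex (r_x x)) -[RHS](iter_findex (r_x y)) eq_i eq_r.
  have lt_x : findex f (r x) x < fingraph.order g (s (r x)) by rewrite ord_s findex_max.
  have lt_y : findex f (r y) y < fingraph.order g (s (r x)).
    by rewrite eq_s ord_s findex_max.
  by rewrite -(findex_iter lt_x) -[RHS](findex_iter lt_y) -/(h x) eq_h /h eq_s.
have eq_r : r (f x) = r x by apply/esym/(fingraph.rootP sym_f)/fconnect1.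
rewrite /h eq_r -iterS.
set i := findex f (r x) x.
have fx : f x = iter i.+1 f (r x) by rewrite iterS iter_findex.
have : i.+1 <= fingraph.order f (r x) by apply: findex_max.
rewrite leq_eqVlt => /predU1P[Ei | lt_i]; last by rewrite {1}fx findex_iter.
by rewrite {1}fx Ei iter_order // findex0 -ord_s iter_order.
Qed.

(** A nonempty fibre of a homomorphism is a translate of its kernel. *)
Lemma card_fibre (T : finZmodType) (k : T -> T) (A : {set T}) y :
  {morph k : x z / (x - z)%R} -> {in A &, forall x z, (x - z)%R \in A} ->
  y \in k @: A -> #|[set x in A | k x == y]| = #|[set x in A | k x == 0%R]|.
Proof.
move=> kB AB /imsetP[x0 Ax0 ->{y}].
have k0 : k 0%R = 0%R by have := kB x0 x0; rewrite !GRing.subrr.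
have A0 : 0%R \in A by rewrite -(GRing.subrr x0) AB.
have kN z : k (- z)%R = (- k z)%R by rewrite -GRing.sub0r kB k0 GRing.sub0r.
rewrite -(card_imset _ (GRing.addIr (- x0)%R)).
apply: eq_card => x; apply/imsetP/idP=> [[y]|].
  by rewrite !inE => /andP[Ay /eqP kyx] ->; rewrite AB //= kB kyx GRing.subrr.
rewrite inE => /andP[Ax /eqP kx]; exists (x + x0)%R; last by rewrite GRing.addrK.
rewrite inE -[x0 in (x + x0)%R]GRing.opprK AB ?kB ?kx ?kN.
- by rewrite GRing.sub0r GRing.opprK eqxx.
- exact: Ax.
- by rewrite -GRing.sub0r AB.
Qed.

(** The images decrease, so each one that is not stationary loses a point. *)
Lemma stationary_images (T : finType) (f : T -> T) :
  let I i := iter i (fun A : {set T} => f @: A) [set: T] in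
  exists N, I N.+1 = I N.
Proof.
move=> I.
have I_dec i : I i.+1 \subset I i.
  by elim: i => [|i IHi]; [apply: subsetT | apply: imsetS].
suffices step N : (exists i, I i.+1 = I i) \/ #|I N| + N <= #|T|.
  by have [//|] := step #|T|.+1; lia.
elim: N => [|N [|IHN]]; [by right; rewrite addn0 max_card | by left|].
have := I_dec N; rewrite subEproper => /predU1P[eqI | ltI]; first by left; exists N.
right; have := proper_card ltI; lia.
Qed.

(** The images of the powers of [f] and [g] are the same subgroups [I i].  A
    conjugacy of [f] and [g] is built first on a stationary image, then on
    [I i] by descending induction on [i]: a new point of [I i] lying over
    [w \in I i.+1] has to go to a new point over the image of [w], and the
    numbers of new points over the two are equal. *)
Theorem conjugate_commuting_endomorphisms (T : finZmodType) (f g : T -> T) :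
  {morph f : x y / (x - y)%R} -> {morph g : x y / (x - y)%R} ->
  (forall x, f (g x) = g (f x)) ->
  (forall x, (f x == 0%R) = (g x == 0%R)) ->
  f @: [set: T] = g @: [set: T] ->
  (forall x m, (iter m f x == x) = (iter m g x == x)) ->
  exists2 h : T -> T, injective h & forall x, h (f x) = g (h x).
Proof.
move=> fB gB fgC eq_ker eq_im eq_per.
pose I i := iter i (fun A : {set T} => f @: A) [set: T].
have IfS i : I i.+1 = f @: I i by [].
have IgS i : I i.+1 = g @: I i.
  elim: i => [|i IHi]; first by rewrite IfS.
  rewrite IfS {1}IHi (IfS i) -!imset_comp; exact: eq_imset.
have IB i : {in I i &, forall x y, (x - y)%R \in I i}.
  elim: i => [x y _ _|i IHi _ _ /imsetP[x Ix ->] /imsetP[y Iy ->]].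
    by rewrite inE.
  by rewrite -fB IfS imset_f ?IHi.
have I_dec i : I i.+1 \subset I i.
  by elim: i => [|i IHi]; [apply: subsetT | apply: imsetS].
have fI i x : x \in I i -> f x \in I i.+1 by move=> Ix; rewrite IfS imset_f.
have gI i x : x \in I i -> g x \in I i.+1 by move=> Ix; rewrite IgS imset_f.
pose H i := exists h : T -> T, {in I i &, injective h} /\
  {in I i, forall x, h x \in I i /\ h (f x) = g (h x)}.
have [N IN] : exists N, I N.+1 = I N := stationary_images f.
(* On a stationary image f and g are permutations with equal periods. *)
have HN : H N.
  have fIN x : x \in I N -> f x \in I N by move/fI; rewrite IN.
  have gIN x : x \in I N -> g x \in I N by move/gI; rewrite IN.
  pose S := {x | x \in I N}.
  have inj_on (k : T -> T) : I N.+1 = k @: I N -> {in I N &, injective k}.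
    by move=> IkS; apply/imset_injP; rewrite -IkS IN.
  pose restr (k : T -> T) (u : S) : S := insubd u (k (val u)).
  have val_f u : val (restr f u) = f (val u).
    by rewrite val_insubd fIN ?(valP u).
  have val_g u : val (restr g u) = g (val u).
    by rewrite val_insubd gIN ?(valP u).
  have iter_f m u : val (iter m (restr f) u) = iter m f (val u).
    by elim: m => //= m <-; rewrite val_f.
  have iter_g m u : val (iter m (restr g) u) = iter m g (val u).
    by elim: m => //= m <-; rewrite val_g.
  have [||u m|h h_inj hC] := @conjugate_of_equal_periods S (restr f) (restr g).
  - move=> u w /(congr1 val); rewrite !val_f => eq_f; apply/val_inj.
    by apply: (inj_on f) eq_f; rewrite ?(valP u) ?(valP w).
  - move=> u w /(congr1 val); rewrite !val_g => eq_g; apply/val_inj.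
    by apply: (inj_on g) eq_g; rewrite ?(valP u) ?(valP w).
  - by rewrite -!val_eqE /= iter_f iter_g eq_per.
  exists (fun x => if insub x is Some u then val (h u) else x); split.
    move=> x y Ix Iy; rewrite !insubT => /val_inj/h_inj/(congr1 val); exact.
  move=> x Ix; rewrite insubT; split; first exact: valP.
  have Ifx := fIN x Ix.
  rewrite insubT -val_g -hC; congr (val (h _)); apply: val_inj.
  by rewrite val_f.
have step i : H i.+1 -> H i.
  case=> h [h_inj hP].
  have im_h : h @: I i.+1 = I i.+1.
    apply/eqP; rewrite eqEcard card_in_imset // leqnn andbT.
    by apply/subsetP=> _ /imsetP[x Ix ->]; case: (hP x Ix).
  pose D := I i :\: I i.+1.
  pose c j := #|[set x in I j | f x == 0%R]|.
  have fibre_f j y : y \in I j.+1 -> #|[set x in I j | f x == y]| = c j.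
    by move=> Iy; apply: card_fibre => //; apply: IB.
  have fibre_g j y : y \in I j.+1 -> #|[set x in I j | g x == y]| = c j.
    move=> Iy; rewrite /c (card_fibre gB (@IB j)) -?IgS //.
    by apply: eq_card => x; rewrite !inE eq_ker.
  (* The points over y in I i, less those over y in I i.+1, where the latter
     exist exactly when y is in I i.+2. *)
  have fibre_D (k : T -> T) : (forall j, I j.+1 = k @: I j) ->
      (forall j y, y \in I j.+1 -> #|[set x in I j | k x == y]| = c j) ->
      forall y, y \in I i.+1 ->
      #|[set x in D | k x == y]| = c i - (y \in I i.+2) * c i.+1.
    move=> IkS fibre_k y Iy.
    have := cardsID (I i.+1) [set x in I i | k x == y]; rewrite fibre_k //.
    have -> : [set x in I i | k x == y] :\: I i.+1 = [set x in D | k x == y].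
      by apply/setP=> x; rewrite !inE andbA.
    have -> : [set x in I i | k x == y] :&: I i.+1 = [set x in I i.+1 | k x == y].
      apply/setP=> x; rewrite !inE andbC.
      by case: (boolP (x \in I i.+1)) => [/(subsetP (I_dec i)) ->|].
    have [Iy2 | nIy2] := boolP (y \in I i.+2); first by rewrite fibre_k //; lia.
    rewrite (_ : [set x in I i.+1 | k x == y] = set0) ?cards0; first by lia.
    apply/setP=> x; rewrite !inE; apply: contraNF nIy2 => /andP[Ix /eqP <-].
    by rewrite IkS imset_f.
  (* A conjugacy on I i.+1 preserves the image of I i.+1, so the two counts
     above agree at w and at h w. *)
  have h2 w : w \in I i.+1 -> (h w \in I i.+2) = (w \in I i.+2).
    move=> Iw; apply/idP/idP.
      rewrite IgS => /imsetP[y]; rewrite -{1}im_h => /imsetP[w' Iw' ->].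
      have Ifw := subsetP (I_dec i.+1) _ (fI _ _ Iw').
      by have [_ <-] := hP w' Iw' => /h_inj E; rewrite (E Iw Ifw) -IgS fI.
    rewrite {1}IfS => /imsetP[w' Iw' ->]; have [Ihw' ->] := hP w' Iw'.
    by rewrite gI.
  have [|s [s_inj sP]] := @matching_of_equal_fibres T _ D D (fun x => h (f x)) g.
    move=> z; have [Iz | nIz] := boolP (z \in I i.+1); last first.
      have IkD x : x \in D -> x \in I i by case/setDP.
      rewrite !eq_card0 // => x; rewrite inE;
      apply: contraNF nIz => /andP[/IkD Ix /eqP <-].
        exact: gI.
      by case: (hP (f x)) => //; apply: fI.
    have [w Iw Ez] : exists2 w, w \in I i.+1 & z = h w by apply/imsetP; rewrite im_h.
    rewrite (fibre_D g) // {1 2}Ez h2 // -(fibre_D f) //.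
    apply: eq_card => x; rewrite !inE.
    case: (boolP (x \in I i)) => Ix; last by rewrite !andbF.
    by congr (_ && _); rewrite (inj_in_eq h_inj) ?fI.
  exists (fun x => if x \in I i.+1 then h x else s x).
  have inD x : x \in I i -> x \notin I i.+1 -> x \in D by move=> *; apply/setDP.
  split=> [x y Ix Iy | x Ix].
    case: ifPn => Ix1; case: ifPn => Iy1; first exact: h_inj.
    - move=> eq_hs; have /andP[/setDP[_]] := sP y (inD y Iy Iy1).
      by rewrite -eq_hs; case: (hP x Ix1) => ->.
    - move=> eq_hs; have /andP[/setDP[_]] := sP x (inD x Ix Ix1).
      by rewrite eq_hs; case: (hP y Iy1) => ->.
    by apply: s_inj; apply: inD.
  rewrite fI //; case: ifPn => Ix1.
    by have [Ihx hC] := hP x Ix1; rewrite (subsetP (I_dec i)).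
  by have /andP[/setDP[Isx _] /eqP ->] := sP x (inD x Ix Ix1).
have [h [h_inj hP]] : H 0 by elim: N HN {IN} => // N IHN /step.
exists h => [x y|x]; first by apply: h_inj; rewrite inE.
by case: (hP x); rewrite // inE.
Qed.

(** * Isomorphic multiplications on a cyclic group *)

(** The invariant of the isomorphism type of multiplication by [a] on Z/n: which
    points are killed by [a] and which are fixed by [a ^ m].  A point of
    additive order [d] is killed if [d] divides [a], and fixed if [a ^ m] is 1
    modulo [d]. *)
Definition same_congruences (n a b : nat) : Prop :=
  forall d, d %| n -> (d %| a) = (d %| b) /\
    forall m, (a ^ m == 1 %[mod d]) = (b ^ m == 1 %[mod d]).

Lemma dvdn_mul_gcd N a x : 0 < N -> (N %| a * x) = (N %/ gcdn N x %| a).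
Proof.
move=> N_gt0; have g_gt0 : 0 < gcdn N x by rewrite gcdn_gt0 N_gt0.
set g := gcdn N x in g_gt0 *.
have [gN gx] : g %| N /\ g %| x by rewrite dvdn_gcdl dvdn_gcdr.
rewrite -{1}(divnK gN) -{1}(divnK gx) mulnA dvdn_pmul2r // Gauss_dvdl //.
by rewrite /coprime -(eqn_pmul2r g_gt0) muln_gcdl !divnK // mul1n.
Qed.

(** This is [dvdn_mul_gcd] for [c - 1].  To make the subtraction exact, [c] is
    first replaced by [c + N], which is at least 1. *)
Lemma eqn_mod_mul_gcd N c x : 0 < N ->
  (c * x == x %[mod N]) = (c == 1 %[mod N %/ gcdn N x]).
Proof.
move=> N_gt0; have dN : N %/ gcdn N x %| N by rewrite dvdn_div ?dvdn_gcdl.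
have -> : (c * x == x %[mod N]) = ((c + N) * x == x %[mod N]).
  by rewrite mulnDl addnC [N * x]mulnC modnMDl.
have -> : (c == 1 %[mod N %/ gcdn N x]) = (c + N == 1 %[mod N %/ gcdn N x]).
  by rewrite -modnDmr (eqP dN) addn0.
have c1_gt0 : 0 < c + N by rewrite addn_gt0 N_gt0 orbT.
rewrite (@eqn_mod_dvd _ (c + N) 1) // -dvdn_mul_gcd // mulnBl mul1n -eqn_mod_dvd //.
by rewrite leq_pmull.
Qed.

(** By Bezout [a] divides [gcdn a N + k * N] for some [k]; the solution is the
    quotient times [b / gcdn a N]. *)
Lemma solve_congruence N a b : 0 < N -> gcdn a N %| b -> exists u, a * u = b %[mod N].
Proof.
move=> N_gt0 /dvdnP[c ->]; have [->|a_gt0] := posnP a.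
  by exists 0; rewrite gcd0n muln0 modnMl mod0n.
have [k _ /dvdnP[v Ev]] := Bezoutl N a_gt0.
exists (v * c); rewrite mulnA [a * v]mulnC -Ev mulnDl [k * N]mulnC -mulnA addnC.
by rewrite [N * _]mulnC modnMDl mulnC.
Qed.

Section CyclicGroup.

Variable n : nat.
Implicit Types (x y : 'I_n.+1) (a b c m : nat).

Definition multiplication a : {ffun 'I_n.+1 -> 'I_n.+1} := [ffun x => (x *+ a)%R].

Lemma val_mulrn x a : (x *+ a)%R = a * x %% n.+1 :> nat.
Proof. by rewrite Zp_mulrn /= mulnC. Qed.

Lemma mulrn_eq0 x a : ((x *+ a)%R == 0%R) = (n.+1 %/ gcdn n.+1 x %| a).
Proof. by rewrite -val_eqE /= val_mulrn -dvdn_mul_gcd. Qed.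

Lemma mulrn_eq_id x c : ((x *+ c)%R == x) = (c == 1 %[mod n.+1 %/ gcdn n.+1 x]).
Proof. by rewrite -val_eqE /= val_mulrn -eqn_mod_mul_gcd // [x %% _]modn_small. Qed.

Lemma iter_multiplication a m x : iter m (multiplication a) x = (x *+ a ^ m)%R.
Proof.
elim: m => [|m IHm]; first by rewrite expn0 GRing.mulr1n.
by rewrite iterS IHm ffunE -GRing.mulrnA expnSr.
Qed.

(** The image of multiplication by [a] is the subgroup of multiples of
    gcd (a, n + 1), and so contains that of every multiple of this gcd. *)
Lemma image_multiplication a b : gcdn a n.+1 %| b ->
  multiplication b @: [set: 'I_n.+1] \subset multiplication a @: [set: 'I_n.+1].
Proof.
case/solve_congruence => // u Eu; apply/subsetP=> _ /imsetP[x _ ->].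
apply/imsetP; exists (x *+ u)%R; rewrite ?inE //.
apply: val_inj; rewrite /= !ffunE -GRing.mulrnA !val_mulrn.
by rewrite [u * a]mulnC -[RHS]modnMml Eu modnMml.
Qed.

(** The solutions of [c * x = 0] modulo N are the multiples of N / gcd (c, N). *)
Lemma card_annihilated c : #|[set x : 'I_n.+1 | n.+1 %| c * x]| = gcdn c n.+1.
Proof.
have N_gt0 := ltn0Sn n; set N := n.+1 in N_gt0 *.
have g_gt0 : 0 < gcdn c N by rewrite gcdn_gt0 N_gt0 orbT.
have gN := dvdn_gcdr c N.
pose d := N %/ gcdn N c; have dN : d %| N by rewrite dvdn_div ?dvdn_gcdl.
have -> : gcdn c N = N %/ d.
  by rewrite /d gcdnC divnA ?dvdn_gcdl // mulKn.
have -> : N %/ d = \sum_(0 <= i < N) (d %| i).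
  by rewrite divn_count_dvd [RHS]big_ltn // big_nat_recr //= dN dvdn0 addnC.
rewrite -sum1_card big_mkcond big_mkord /=; apply: eq_bigr => x _.
by rewrite inE mulnC dvdn_mul_gcd // -/d; case: (d %| x).
Qed.

(** Here [c + n] stands for [c - 1] modulo [n.+1]; it is also right for
    [c = 0]. *)
Lemma card_fixed c : #|[set x : 'I_n.+1 | (x *+ c)%R == x]| = gcdn (c + n) n.+1.
Proof.
rewrite -card_annihilated; apply: eq_card => x; rewrite !inE -val_eqE /= val_mulrn.
rewrite -[X in _ == X](@modn_small x n.+1) // -(eqn_modDr (n * x)) -mulnDl -mulSn.
by rewrite [n.+1 * x]mulnC modnMl.
Qed.

Lemma isomorphic_state_spaces (f g : {ffun 'I_n.+1 -> 'I_n.+1}) :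
  reflect (exists2 h : 'I_n.+1 -> 'I_n.+1, injective h & forall x, h (f x) = g (h x))
    (isomorphic (state_space f) (state_space g)).
Proof.
apply: (iffP existsP) => [[h /forallP hP] | [h h_inj hC]].
  exists h => [|x]; first exact: perm_inj.
  by move/forallP: (hP x) => /(_ (f x)); rewrite !inE /= eqxx eq_sym eqb_id => /eqP.
exists (perm h_inj); apply/forallP=> x; apply/forallP=> y.
by rewrite !inE /= !permE -hC (inj_eq h_inj).
Qed.

Lemma same_congruences_iso a b : same_congruences n.+1 a b ->
  isomorphic (state_space (multiplication a)) (state_space (multiplication b)).
Proof.
move=> simab; apply/isomorphic_state_spaces.
have mulB c : {morph multiplication c : x y / (x - y)%R}.
  by move=> x y; rewrite !ffunE GRing.mulrnBl.
have dvd_gcd x : n.+1 %/ gcdn n.+1 x %| n.+1 by rewrite dvdn_div ?dvdn_gcdl.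
apply: conjugate_commuting_endomorphisms => // [x|x||x m].
- by rewrite !ffunE -!GRing.mulrnA mulnC.
- by rewrite !ffunE !mulrn_eq0; case: (simab _ (dvd_gcd x)).
- apply/eqP; rewrite eqEsubset !image_multiplication //.
    by have [<- _] := simab _ (dvdn_gcdr a n.+1); apply: dvdn_gcdl.
  by have [-> _] := simab _ (dvdn_gcdr b n.+1); apply: dvdn_gcdl.
- rewrite !iter_multiplication !mulrn_eq_id.
  by case: (simab _ (dvd_gcd x)).
Qed.

(** The change of variables (x, y) to (x - y, y) turns the equation into
    [a * x = 0].  Counting pairs gives an invariant of the digraph, while the
    kernel itself refers to the point 0, which a digraph isomorphism can
    move. *)
Lemma card_equal_images a :
  #|[set xy : 'I_n.+1 * 'I_n.+1 | multiplication a xy.1 == multiplication a xy.2]|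
    = n.+1 * gcdn a n.+1.
Proof.
pose F (xy : 'I_n.+1 * 'I_n.+1) := ((xy.1 - xy.2)%R, xy.2).
have F_inj : injective F.
  move=> [x y] [x' y'] eqF; have /= eq_y := congr1 snd eqF.
  have := congr1 fst eqF; rewrite /= eq_y => eq_B.
  by rewrite (GRing.addIr _ eq_B).
rewrite -(card_imset _ F_inj) -card_annihilated mulnC -[X in _ * X]card_ord.
rewrite -cardsT -cardsX; apply: eq_card => -[x y].
rewrite !inE andbT; apply/imsetP/idP => [[[x' y']]|].
  rewrite inE /= !ffunE => /eqP eqa [-> _].
  by rewrite /dvdn -val_mulrn GRing.mulrnBl eqa GRing.subrr.
move=> ax; exists ((x + y)%R, y); last by rewrite /F /= GRing.addrK.
rewrite inE /= !ffunE GRing.mulrnDl -GRing.subr_eq0 GRing.addrK.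
by rewrite -val_eqE /= val_mulrn.
Qed.

Lemma iso_same_congruences a b :
  isomorphic (state_space (multiplication a)) (state_space (multiplication b)) ->
  same_congruences n.+1 a b.
Proof.
case/isomorphic_state_spaces => h h_inj hC.
have [h' hK h'K] := injF_bij h_inj.
have eq_gcd : gcdn a n.+1 = gcdn b n.+1.
  apply/eqP; rewrite -(eqn_pmul2l (ltn0Sn n)) -!card_equal_images; apply/eqP.
  have H_inj : injective (fun xy : 'I_n.+1 * 'I_n.+1 => (h xy.1, h xy.2)).
    by move=> [x y] [x' y'] [/h_inj -> /h_inj ->].
  rewrite -(card_imset _ H_inj); apply: eq_card => -[x y].
  rewrite inE /=; apply/imsetP/idP => [[[x' y']]|].
    by rewrite inE /= => /eqP eqa [-> ->]; rewrite -!hC eqa.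
  move=> eqb; exists (h' x, h' y); last by rewrite /= !h'K.
  by rewrite inE /= -(inj_eq h_inj) !hC !h'K.
have eq_fix m : gcdn (a ^ m + n) n.+1 = gcdn (b ^ m + n) n.+1.
  have hCm x : h (x *+ a ^ m)%R = (h x *+ b ^ m)%R.
    by rewrite -!iter_multiplication; elim: m => //= m <-; rewrite hC.
  rewrite -!card_fixed -(card_imset _ h_inj); apply: eq_card => x.
  rewrite inE; apply/imsetP/idP => [[y]|].
    by rewrite inE => /eqP fy ->; rewrite -hCm fy.
  by move=> fx; exists (h' x); rewrite ?inE ?h'K // -(inj_eq h_inj) hCm h'K.
move=> d dN; split=> [|m].
  by rewrite -[d %| a]andbT -[d %| b]andbT -!dN -!dvdn_gcd eq_gcd.
have E c : (c == 1 %[mod d]) = (d %| gcdn (c + n) n.+1).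
  by rewrite dvdn_gcd dN andbT -(eqn_modDr n) add1n (eqP dN).
by rewrite !E eq_fix.
Qed.

End CyclicGroup.

(** * Endomorphisms, connectedness and unions of cycles *)

Section CyclicGroup.

Variable n : nat.
Implicit Types (x y : 'I_n.+1) (a b c m : nat).

(** An endomorphism is determined by the image of the generator 1. *)
Lemma state_spacesP (D : digraph (Zmod n.+1)) :
  reflect (exists a, D = state_space (multiplication n a))
    (D \in state_spaces (Zmod n.+1)).
Proof.
apply: (iffP imsetP) => [[phi]|[a ->]].
  rewrite inE => /morphicP phiM ->; exists (phi Zp1).
  have phi_nat k : phi (Zp1 *+ k)%R = (phi Zp1 *+ k)%R.
    elim: k => [|k IHk]; last by rewrite !GRing.mulrSr -IHk; apply: phiM; rewrite inE.
    rewrite !GRing.mulr0n; apply: (@GRing.addrI _ (phi 0%R)); rewrite GRing.addr0.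
    by rewrite -[LHS]phiM ?inE // [mulg _ _]GRing.addr0.
  congr state_space; apply/ffunP=> x; rewrite ffunE.
  have {1}-> : x = (Zp1 *+ x)%R.
    by apply: val_inj; rewrite /= val_mulrn modnMmr muln1 modn_small.
  by rewrite phi_nat; apply: val_inj; rewrite /= !val_mulrn mulnC.
exists (multiplication n a) => //; rewrite inE; apply/morphicP=> x y _ _.
by rewrite !ffunE; apply: GRing.mulrnDl.
Qed.

(** The points that eventually reach 0 are closed under following arcs in
    either direction.  So if the digraph is connected the point 1 reaches 0,
    which is to say that a power of [a] vanishes. *)
Lemma weakly_connected_multiplication a :
  weakly_connected (state_space (multiplication n a)) <-> exists m, n.+1 %| a ^ m.
Proof.
set e := [rel u v | ((u, v) \in state_space (multiplication n a))
                    || ((v, u) \in state_space (multiplication n a))].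
have sym_e : connect_sym e by apply: sym_connect_sym => u v; rewrite /= orbC.
split=> [/forallP/(_ 0%R)/forallP/(_ Zp1) | [m am] ].
  pose nilp u := exists m, iter m (multiplication n a) u = 0%R.
  have mul0 : multiplication n a 0%R = 0%R by rewrite ffunE GRing.mul0rn.
  have nilpE u : nilp (multiplication n a u) <-> nilp u.
    split=> -[m Em]; first by exists m.+1; rewrite iterSr.
    by exists m; rewrite -iterSr iterS Em mul0.
  case/connectP => p path_p Ep; suffices: nilp Zp1.
    case=> m; rewrite iter_multiplication => /(congr1 val).
    rewrite /= val_mulrn; move/eqP.
    by rewrite modnMmr muln1; exists m.
  have : nilp 0%R by exists 0.
  rewrite {}Ep; elim: p 0%R path_p => //= v p IHp u /andP[/orP euv path_p] nil_u.
  apply: IHp path_p _; case: euv; rewrite !inE => /eqP /= Eq.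
    by rewrite Eq nilpE.
  by rewrite -nilpE -Eq.
have conn0 x : connect e x 0%R.
  have -> : 0%R = iter m (multiplication n a) x.
    rewrite iter_multiplication; apply/esym/eqP.
    by rewrite -val_eqE /= val_mulrn -/(dvdn _ _) dvdn_mulr.
  elim: m {am} => //= m IHm; apply: connect_trans IHm (connect1 _).
  by rewrite /= !inE eqxx.
apply/forallP=> x; apply/forallP=> y.
by rewrite (connect_trans (conn0 x)) // sym_e.
Qed.

End CyclicGroup.

(** Inside a block [f] is the successor map of a duplicate-free cycle, hence
    injective, and [f] preserves the blocks.  Conversely the orbits of an
    injective map are cycles. *)
Lemma disjoint_union_of_cycles_injective (T : finType) (f : T -> T) :
  disjoint_union_of_cycles [set xy : T * T | xy.2 == f xy.1] <-> injective f.
Proof.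
split=> [/existsP[P /and3P[partP /forallP cycP /forallP blockP]] | f_inj].
  have [/eqP covP trivP _] := and3P partP.
  have blk x : x \in pblock P x by rewrite mem_pblock covP inE.
  have fblk x : pblock P (f x) = pblock P x.
    by move/forallP: (blockP x) => /(_ (f x)); rewrite inE /= eqxx => /eqP.
  move=> x y eqf; have eqb : pblock P y = pblock P x by rewrite -fblk -eqf fblk.
  have PB : pblock P x \in P by rewrite pblock_mem // covP inE.
  have /existsP[c /and3P[c_uniq _ /forallP arcs]] := implyP (cycP _) PB.
  have next_c z : z \in pblock P x -> f z = next c z.
    move=> zB; have fzB : f z \in pblock P x.
      by rewrite -(same_pblock trivP zB) -fblk blk.
    have /implyP/(_ zB)/forallP/(_ (f z))/implyP/(_ fzB) := arcs z.
    by rewrite inE /= eqxx => /eqP/esym/eqP.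
  by rewrite -(prev_next c_uniq x) -next_c // eqf next_c -?eqb // prev_next.
have sym_f := fconnect_sym f_inj.
pose P := preim_partition (froot f) [set: T].
have partP : partition P [set: T] by apply: preim_partitionP.
have eqv : {in [set: T] & &, equivalence_rel (fun x y => froot f x == froot f y)}.
  by split=> // /eqP->.
apply/existsP; exists P; apply/and3P; split=> //; last first.
  apply/forallP=> x; apply/forallP=> y; apply/implyP; rewrite inE /= => /eqP ->.
  have [/eqP covP trivP _] := and3P partP.
  rewrite eq_pblock ?covP ?inE // pblock_equivalence_partition ?inE //.
  exact/eqP/(fingraph.rootP sym_f)/fconnect1.
apply/forallP=> B; apply/implyP => /imsetP[x _ defB].
have memB y : (y \in B) = fconnect f x y.
  by rewrite defB !inE /=; apply/eqP/idP => /(fingraph.rootP sym_f).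
have cardB : size (fingraph.orbit f x) == #|B|.
  by rewrite size_orbit; apply/eqP/eq_card => y; rewrite memB.
apply/existsP; exists (Tuple cardB); apply/and3P; split=> /=.
- exact: fingraph.orbit_uniq.
- by apply/eqP/setP=> y; rewrite inE memB fconnect_orbit.
apply/forallP=> y; apply/implyP; rewrite memB fconnect_orbit => xy.
apply/forallP=> z; apply/implyP => _; rewrite inE /=.
by rewrite -(eqP (next_cycle (cycle_orbit f_inj x) xy)).
Qed.

Lemma cycle_unions_multiplication n a :
  disjoint_union_of_cycles (state_space (multiplication n a)) <-> coprime a n.+1.
Proof.
have -> : state_space (multiplication n a)
          = [set xy | xy.2 == multiplication n a xy.1] by [].
rewrite disjoint_union_of_cycles_injective; split=> [mul_inj | co_a x y].
  rewrite /coprime -card_annihilated -(cards1 (0%R : 'I_n.+1)); apply/eqP/eq_card => x.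
  rewrite !inE -(inj_eq mul_inj) !ffunE GRing.mul0rn -val_eqE /=.
  by rewrite val_mulrn.
rewrite !ffunE => eq_a; apply/eqP; rewrite -GRing.subr_eq0.
have : ((x - y) *+ a)%R == 0%R by rewrite GRing.mulrnBl eq_a GRing.subrr.
rewrite -!val_eqE /= val_mulrn -/(dvdn _ _) Gauss_dvdr 1?coprime_sym //.
by rewrite /dvdn modn_small.
Qed.

(** * Counting classes of multipliers, and the Chinese remainder theorem *)

(** The number of classes of [same_congruences n] among the multipliers that
    satisfy [P] is given by a system of representatives indexed by a finite
    type: disjoint unions and products of systems are then sum and product
    types. *)
Definition has_class_count (n : nat) (P : nat -> Prop) (N : nat) : Prop :=
  exists (I : finType) (r : I -> nat),
    [/\ #|I| = N, forall i, P (r i),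
        forall i j, same_congruences n (r i) (r j) -> i = j
      & forall a, P a -> exists i, same_congruences n a (r i)].

Lemma card_isotypes n P N (S : {set digraph (Zmod n.+1)}) :
  (forall D, D \in S <-> exists a, P a /\ D = state_space (multiplication n a)) ->
  has_class_count n.+1 P N -> #|isotypes S| = N.
Proof.
move=> memS [I [r [<- rP r_inj r_surj]]].
pose F i := isotype (state_space (multiplication n (r i))).
have F_inj : injective F.
  by move=> i j /eqP; rewrite isotype_eq => /iso_same_congruences/r_inj.
rewrite -[RHS]cardsT -(card_imset _ F_inj).
apply: eq_card => C; apply/imsetP/imsetP => [[D /memS[a [Pa ->]] ->] | [i _ ->]].
  have [i sim_i] := r_surj a Pa; exists i; first exact: in_setT.
  by apply/eqP; rewrite isotype_eq same_congruences_iso.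
exists (state_space (multiplication n (r i))) => //.
by apply/memS; exists (r i).
Qed.

Lemma same_congruences_sym n a b : same_congruences n a b -> same_congruences n b a.
Proof. by move=> sim d /sim[-> eqm]; split=> // m; rewrite eqm. Qed.

Lemma same_congruences_trans n a b c :
  same_congruences n a b -> same_congruences n b c -> same_congruences n a c.
Proof.
move=> simab simbc d dn; have [-> eqab] := simab d dn; have [-> eqbc] := simbc d dn.
by split=> // m; rewrite eqab.
Qed.

Lemma same_congruences_mod n a b : a = b %[mod n] -> same_congruences n a b.
Proof.
move=> eq_ab d dn; have eq_d : a = b %[mod d].
  by rewrite -(modn_dvdm a dn) eq_ab modn_dvdm.
by split=> [|m]; rewrite /dvdn ?eq_d // -modnXm eq_d modnXm.
Qed.

(** A divisor of [n1 * n2] is the product of coprime divisors of [n1] and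
    [n2]. *)
Lemma same_congruences_coprime n1 n2 a b : 0 < n1 -> coprime n1 n2 ->
  same_congruences (n1 * n2) a b <-> same_congruences n1 a b /\ same_congruences n2 a b.
Proof.
move=> n1_gt0 co_n; split=> [sim|[sim1 sim2] d dn].
  by split=> d dn; apply: sim; [apply: dvdn_mulr | apply: dvdn_mull].
pose d1 := gcdn d n1; pose d2 := d %/ d1.
have d1_gt0 : 0 < d1 by rewrite gcdn_gt0 n1_gt0 orbT.
have d1n : d1 %| n1 := dvdn_gcdr d n1.
have Ed : d = d1 * d2 by rewrite mulnC divnK // dvdn_gcdl.
have d2n : d2 %| n2.
  have co_d2 : coprime d2 (n1 %/ d1).
    by rewrite /coprime -(eqn_pmul2r d1_gt0) muln_gcdl !divnK ?mul1n ?dvdn_gcdl.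
  rewrite -(Gauss_dvdr n2 co_d2) -(dvdn_pmul2l d1_gt0) -Ed mulnA [d1 * _]mulnC divnK //.
have co_d : coprime d1 d2 := coprime_dvdl d1n (coprime_dvdr d2n co_n).
have [dv1 eq1] := sim1 _ d1n; have [dv2 eq2] := sim2 _ d2n.
rewrite Ed !Gauss_dvd // dv1 dv2; split=> // m.
by rewrite !chinese_remainder // eq1 eq2.
Qed.

(** The conditions on a multiplier that can be tested modulo each of several
    coprime factors of the modulus. *)
Record crt_property (P : nat -> nat -> Prop) : Prop := CrtProperty {
  crt_one : forall a, P 1 a;
  crt_mod : forall n a b, a = b %[mod n] -> P n a -> P n b;
  crt_mul : forall n1 n2 a, coprime n1 n2 -> P (n1 * n2) a <-> P n1 a /\ P n2 a
}.

Lemma has_class_count_one P : crt_property P -> has_class_count 1 (P 1) 1.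
Proof.
move=> crtP; exists unit, (fun=> 0).
split=> [|i|[] []|a _]; rewrite ?card_unit //; first exact: crt_one.
by exists tt; apply: same_congruences_mod; rewrite !modn1.
Qed.

(** Representatives modulo [n1 * n2] are the Chinese combinations of
    representatives modulo [n1] and modulo [n2]. *)
Lemma has_class_count_mul P n1 n2 N1 N2 : crt_property P -> 0 < n1 -> coprime n1 n2 ->
  has_class_count n1 (P n1) N1 -> has_class_count n2 (P n2) N2 ->
  has_class_count (n1 * n2) (P (n1 * n2)) (N1 * N2).
Proof.
move=> crtP n1_gt0 co_n [I [r [<- rP r_inj r_surj]]] [J [s [<- sP s_inj s_surj]]].
pose t (ij : I * J) := chinese n1 n2 (r ij.1) (s ij.2).
have t1 ij : t ij = r ij.1 %[mod n1] by apply: chinese_modl.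
have t2 ij : t ij = s ij.2 %[mod n2] by apply: chinese_modr.
have sim1 ij := same_congruences_mod (t1 ij).
have sim2 ij := same_congruences_mod (t2 ij).
exists (I * J)%type, t; split=> [|ij|ij ij' /same_congruences_coprime|a].
- by rewrite card_prod.
- apply/(crt_mul crtP) => //; split.
    exact: crt_mod (esym (t1 ij)) (rP _).
  exact: crt_mod (esym (t2 ij)) (sP _).
- case=> // eq1 eq2; rewrite [ij]surjective_pairing [ij']surjective_pairing.
  congr (_, _); [apply: r_inj | apply: s_inj].
    apply: same_congruences_trans (sim1 ij'); apply: same_congruences_trans eq1.
    exact/same_congruences_sym/sim1.
  apply: same_congruences_trans (sim2 ij'); apply: same_congruences_trans eq2.
  exact/same_congruences_sym/sim2.
case/(crt_mul crtP) => // /r_surj[i sim_i] /s_surj[j sim_j]; exists (i, j).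
apply/same_congruences_coprime => //; split.
  by apply: same_congruences_trans sim_i _; apply/same_congruences_sym/sim1.
by apply: same_congruences_trans sim_j _; apply/same_congruences_sym/sim2.
Qed.

Lemma has_class_count_prod P (I : eqType) (s : seq I) (q N : I -> nat) :
  crt_property P -> uniq s -> (forall i, 0 < q i) ->
  (forall i j, i != j -> coprime (q i) (q j)) ->
  (forall i, has_class_count (q i) (P (q i)) (N i)) ->
  has_class_count (\prod_(i <- s) q i) (P (\prod_(i <- s) q i)) (\prod_(i <- s) N i).
Proof.
move=> crtP + q_gt0 co_q cntN; elim: s => [_|i s IHs /= /andP[s'i uniq_s]].
  by rewrite !big_nil; apply: has_class_count_one.
rewrite !big_cons; apply: has_class_count_mul => //; last exact: IHs.
rewrite big_seq; elim/big_ind: _ => [|m1 m2 co1 co2|j sj]; first exact: coprimen1.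
  by rewrite coprimeMr co1.
by apply: co_q; apply: contraNneq s'i => ->.
Qed.

Lemma crt_true : crt_property (fun _ _ => True).
Proof. by split. Qed.

Lemma crt_nilpotent : crt_property (fun n a => exists m, n %| a ^ m).
Proof.
split=> [a|n a b eq_ab [m am]|n1 n2 a co_n].
- by exists 0.
- by exists m; rewrite /dvdn -modnXm -eq_ab modnXm.
split=> [[m am]|[[m1 am1] [m2 am2]]].
  by split; exists m; apply: dvdn_trans am; [apply: dvdn_mulr | apply: dvdn_mull].
by exists (m1 + m2); rewrite expnD dvdn_mul.
Qed.

Lemma crt_coprime : crt_property (fun n a => coprime a n).
Proof.
split=> [a|n a b eq_ab|n1 n2 a co_n].
- exact: coprimen1.
- by rewrite -coprime_modl eq_ab coprime_modl.
by rewrite coprimeMr; split=> /andP.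
Qed.

(** * Lifting the exponent *)

Lemma eqn_mod1_gt0 q A : 1 < q -> A == 1 %[mod q] -> 0 < A.
Proof. by move=> q_gt1; case: A => //; rewrite mod0n modn_small. Qed.

Lemma eqn_mod1_dvd q A : 0 < A -> (A == 1 %[mod q]) = (q %| A.-1).
Proof. by move=> A_gt0; rewrite eqn_mod_dvd // subn1. Qed.

Lemma eqn_mod1_exp q A m : 0 < A ->
  (A ^ m == 1 %[mod q]) = (q %| A.-1 * \sum_(i < m) A ^ i).
Proof. by move=> A_gt0; rewrite eqn_mod1_dvd ?expn_gt0 ?A_gt0 // predn_exp. Qed.

Lemma eqn_mod1X q A m : A == 1 %[mod q] -> A ^ m == 1 %[mod q].
Proof. by move/eqP=> A1; rewrite -modnXm A1 modnXm exp1n. Qed.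

Lemma eqn_mod_dvd_trans d q x y : d %| q -> x == y %[mod q] -> x == y %[mod d].
Proof. by move=> dq /eqP xy; rewrite -(modn_dvdm x dq) xy modn_dvdm. Qed.

Lemma geometric_sum_mod q A m : A == 1 %[mod q] -> \sum_(i < m) A ^ i = m %[mod q].
Proof.
move=> A1; elim: m => [|m IHm]; first by rewrite big_ord0.
rewrite big_ord_recr /= -modnDm IHm (eqP (eqn_mod1X m A1)) modnDm addn1 //.
Qed.

(** Modulo [q ^ 2] the power [(1 + q * c) ^ i] is [1 + i * (q * c)]. *)
Lemma geometric_sum_mod_sqr q c m :
  \sum_(i < m) (1 + q * c) ^ i = m + q * c * 'C(m, 2) %[mod q ^ 2].
Proof.
have powE i : (1 + q * c) ^ i = 1 + i * (q * c) %[mod q ^ 2].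
  elim: i => [|i IHi]; first by rewrite expn0 mul0n.
  rewrite expnSr -modnMml IHi modnMml.
  rewrite (_ : _ * _ = (i * c ^ 2) * q ^ 2 + (1 + i.+1 * (q * c))) ?modnMDl //; nia.
elim: m => [|m IHm]; first by rewrite big_ord0 muln0.
rewrite big_ord_recr /= -modnDm IHm powE modnDm binS bin1.
by congr (_ %% _); nia.
Qed.

(** Bases congruent to 1 modulo p, or modulo 4 when p = 2, are those for which
    raising to the power p increases the valuation of A - 1 by exactly one.
    For p = 2 the congruence modulo 2 is too weak: 3 ^ 2 - 1 = 8. *)
Definition principal_modulus (p : nat) : nat := if p == 2 then 4 else p.

Local Notation principal p A := (A == 1 %[mod principal_modulus p]).

Lemma principal_mod_prime p A : principal p A -> A == 1 %[mod p].
Proof.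
apply: eqn_mod_dvd_trans; rewrite /principal_modulus.
by case: eqP => [->|].
Qed.

(** The cofactor of [A - 1] in [A ^ p - 1] is p modulo p^2, so that p divides it
    exactly once.  For odd p this uses that p divides the binomial coefficient
    ['C(p, 2)]; for p = 2 the cofactor is [A + 1], which is 2 modulo 4. *)
Lemma geometric_sum_prime p A : prime p -> principal p A ->
  exists s, \sum_(i < p) A ^ i = p * s /\ coprime p s.
Proof.
move=> p_pr Apr; have p_gt1 := prime_gt1 p_pr.
have A_gt0 := eqn_mod1_gt0 p_gt1 (principal_mod_prime Apr).
suffices SE : \sum_(i < p) A ^ i = p %[mod p ^ 2].
  exists ((\sum_(i < p) A ^ i) %/ p ^ 2 * p + 1); split.
    rewrite {1}(divn_eq (\sum_(i < p) A ^ i) (p ^ 2)) SE.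
    by rewrite [p %% _]modn_small; nia.
  by rewrite /coprime gcdnMDl gcdn1.
move: Apr; rewrite /principal_modulus; case: (p =P 2) => [-> | p_neq2] A1.
  by rewrite !big_ord_recr big_ord0 /= expn0 expn1 add0n -modnDmr (eqP A1).
have /dvdnP[c Ec] : p %| A.-1 by rewrite -eqn_mod1_dvd.
have -> : A = 1 + p * c by rewrite mulnC -Ec add1n prednK.
rewrite geometric_sum_mod_sqr.
have /dvdnP[b ->] : p %| 'C(p, 2) by apply: prime_dvd_bin => //=; lia.
by rewrite (_ : p + _ = c * b * p ^ 2 + p) ?modnMDl //; nia.
Qed.

Lemma exp_eq1_coprime p A m j : prime p -> A == 1 %[mod p] -> coprime p m ->
  (A ^ m == 1 %[mod p ^ j]) = (A == 1 %[mod p ^ j]).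
Proof.
move=> p_pr A1 co_m; have A_gt0 := eqn_mod1_gt0 (prime_gt1 p_pr) A1.
rewrite eqn_mod1_exp // eqn_mod1_dvd // Gauss_dvdl // coprimeXl //.
by rewrite -coprime_modr (geometric_sum_mod m A1) coprime_modr.
Qed.

Lemma exp_eq1_prime p A j : prime p -> principal p A ->
  (A ^ p == 1 %[mod p ^ j.+1]) = (A == 1 %[mod p ^ j]).
Proof.
move=> p_pr Apr.
have A_gt0 := eqn_mod1_gt0 (prime_gt1 p_pr) (principal_mod_prime Apr).
have [s [Es co_s]] := geometric_sum_prime p_pr Apr.
rewrite eqn_mod1_exp // eqn_mod1_dvd // Es mulnCA expnS dvdn_pmul2l ?prime_gt0 //.
by rewrite Gauss_dvdl // coprimeXl.
Qed.

(** Lifting the exponent: the valuation of [A ^ m - 1] is the sum of those of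
    [A - 1] and [m].  The formulation by congruences also covers [A = 1]; when
    [logn p m] exceeds [j] the truncated exponent is 0, and both sides hold. *)
Lemma exp_eq1_principal p A m j : prime p -> principal p A -> 0 < m ->
  (A ^ m == 1 %[mod p ^ j]) = (A == 1 %[mod p ^ (j - logn p m)]).
Proof.
move=> p_pr Apr m_gt0; have [m0 co_m {1}->] := pfactor_coprime p_pr m_gt0.
set t := logn p m; rewrite mulnC expnM.
rewrite exp_eq1_coprime //; last by rewrite eqn_mod1X // principal_mod_prime.
elim: t A Apr => [|t IHt] A Apr; first by rewrite expn1 subn0.
rewrite expnS expnM IHt; last exact: eqn_mod1X.
by rewrite subnS; case: (j - t) => [|i]; [rewrite !modn1 | rewrite exp_eq1_prime].
Qed.

Lemma eq_powers_of_principal p e A B : prime p -> principal p A -> principal p B ->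
  (forall j, j <= e -> (A == 1 %[mod p ^ j]) = (B == 1 %[mod p ^ j])) ->
  forall m j, j <= e -> (A ^ m == 1 %[mod p ^ j]) = (B ^ m == 1 %[mod p ^ j]).
Proof.
move=> p_pr Apr Bpr eqAB [|m] j le_j //.
by rewrite !exp_eq1_principal // eqAB // (leq_trans (leq_subr _ _)).
Qed.

(** * Nilpotent multipliers modulo a prime power *)

(** The level [w] is the valuation of [x] cut off at [e]; it is defined also for
    [x = 0]. *)
Lemma prime_power_level p e x : prime p -> 0 < e -> p %| x ->
  exists w, [/\ 0 < w, w <= e & forall j, j <= e -> (p ^ j %| x) = (j <= w)].
Proof.
move=> p_pr e_gt0 px; pose g := gcdn x (p ^ e).
have pe_gt0 : 0 < p ^ e by rewrite expn_gt0 prime_gt0.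
have g_gt0 : 0 < g by rewrite gcdn_gt0 pe_gt0 orbT.
exists (logn p g); split=> [||j le_j].
- rewrite logn_gt0 mem_primes p_pr g_gt0 dvdn_gcd px /=.
  by rewrite -{1}(expn1 p) dvdn_exp2l.
- rewrite -(dvdn_Pexp2l _ _ (prime_gt1 p_pr)).
  by rewrite (dvdn_trans (pfactor_dvdnn _ _)) // dvdn_gcdr.
- by rewrite -pfactor_dvdn // dvdn_gcd dvdn_exp2l // andbT.
Qed.

Lemma same_congruences_prime_power p e a b : prime p ->
  (forall j, j <= e -> (p ^ j %| a) = (p ^ j %| b) /\
     forall m, (a ^ m == 1 %[mod p ^ j]) = (b ^ m == 1 %[mod p ^ j])) ->
  same_congruences (p ^ e) a b.
Proof. by move=> p_pr sim d /(dvdn_pfactor _ _ p_pr)[j le_j ->]; apply: sim. Qed.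

Lemma nilpotent_prime_power p e a : prime p -> 0 < e ->
  (exists m, p ^ e %| a ^ m) <-> p %| a.
Proof.
move=> p_pr e_gt0; split=> [[m pm]|pa]; last by exists e; rewrite dvdn_exp2r.
suffices: p %| a ^ m by rewrite Euclid_dvdX // => /andP[].
by apply: dvdn_trans pm; rewrite -{1}(expn1 p) dvdn_exp2l.
Qed.

Lemma coprime_prime_power p e a : prime p -> 0 < e -> coprime a (p ^ e) = ~~ (p %| a).
Proof. by move=> p_pr e_gt0; rewrite coprime_pexpr // coprime_sym prime_coprime. Qed.

Lemma dvd_exp_eq1 p j a m : prime p -> 0 < j -> p %| a ->
  (a ^ m == 1 %[mod p ^ j]) = (m == 0).
Proof.
move=> p_pr j_gt0 pa; case: m => [|m]; first by rewrite !eqxx.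
apply/negP=> /(@eqn_mod_dvd_trans p) E; have {E} := E _.
rewrite -{1}(expn1 p) dvdn_exp2l // => /(_ isT).
by rewrite expnS -modnMml (eqP pa) mul0n mod0n modn_small // prime_gt1.
Qed.

Lemma eq_of_eq_leq (b x y : nat) : x <= b -> y <= b ->
  (forall j, j <= b -> (j <= x) = (j <= y)) -> x = y.
Proof.
move=> xb yb eq_le; apply/eqP.
by rewrite eqn_leq -eq_le // leqnn eq_le ?leqnn.
Qed.

(** No positive power of a multiple of p is 1 modulo p, so only the level of a
    nilpotent multiplier matters. *)
Lemma nilpotent_class_count p e : prime p -> 0 < e ->
  has_class_count (p ^ e) (fun a => exists m, p ^ e %| a ^ m) e.
Proof.
move=> p_pr e_gt0; exists 'I_e, (fun v : 'I_e => p ^ v.+1).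
have p_gt1 := prime_gt1 p_pr.
split=> [|v|v v' sim|a /nilpotent_prime_power pa].
- by rewrite card_ord.
- by apply/nilpotent_prime_power => //; rewrite expnS dvdn_mulr.
- apply/ord_inj/eqP; rewrite -eqSS; apply/eqP; apply: (@eq_of_eq_leq e) => // j le_j.
  by have [+ _] := sim _ (dvdn_exp2l p le_j); rewrite !dvdn_Pexp2l.
have {}pa := pa p_pr e_gt0.
have [[|w] [w_gt0 le_w wP]] := prime_power_level p_pr e_gt0 pa; first by [].
exists (Ordinal le_w) => /=; apply: same_congruences_prime_power => // j le_j.
split=> [|m]; first by rewrite wP // dvdn_Pexp2l.
case: j {le_j} => [|j]; first by rewrite !modn1.
by rewrite !dvd_exp_eq1 // expnS dvdn_mulr.
Qed.

(** A multiplier modulo [p ^ e] is nilpotent if p divides it and a unit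
    otherwise, and [same_congruences] sees which of the two holds. *)
Lemma total_class_count p e N1 N2 : prime p -> 0 < e ->
  has_class_count (p ^ e) (fun a => exists m, p ^ e %| a ^ m) N1 ->
  has_class_count (p ^ e) (fun a => coprime a (p ^ e)) N2 ->
  has_class_count (p ^ e) (fun _ => True) (N1 + N2).
Proof.
move=> p_pr e_gt0 [I [r [<- rP r_inj r_surj]]] [J [s [<- sP s_inj s_surj]]].
have rp i : p %| r i by apply/(nilpotent_prime_power _ p_pr e_gt0).
have sp j : (p %| s j) = false.
  by apply: negbTE; rewrite -(coprime_prime_power _ p_pr e_gt0).
have p_pe : p %| p ^ e by rewrite -{1}(expn1 p) dvdn_exp2l.
exists (I + J)%type, (fun u => match u with inl i => r i | inr j => s j end).
split=> [|//|[i|j] [i'|j'] sim|a _].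
- by rewrite card_sum.
- by rewrite (r_inj i i').
- by have [] := sim p p_pe; rewrite rp sp.
- by have [] := sim p p_pe; rewrite rp sp.
- by rewrite (s_inj j j').
have [pa|npa] := boolP (p %| a).
  have [|i sim] := r_surj a; last by exists (inl i).
  exact/(nilpotent_prime_power _ p_pr e_gt0).
have [|j sim] := s_surj a; last by exists (inr j).
by rewrite coprime_prime_power.
Qed.

(** * Units modulo a power of an odd prime *)

Lemma dvdn_prime_power_coprime p j a : prime p -> ~~ (p %| a) -> (p ^ j %| a) = (j == 0).
Proof.
move=> p_pr npa; case: j => [|j]; first by rewrite dvd1n.
by apply: contraNF npa; apply: dvdn_trans; rewrite expnS dvdn_mulr.
Qed.

Lemma eqF_natX p a m : prime p ->
  ((a%:R : 'F_p)%R ^+ m == 1 :> 'F_p)%R = (a ^ m == 1 %[mod p]).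
Proof.
move=> p_pr; rewrite -GRing.natrX -val_eqE /= val_Fp_nat //.
by rewrite [1 %% p]modn_small ?prime_gt1.
Qed.

(** In the field with p elements [d] is the multiplicative order of [a]. *)
Lemma order_mod_prime p a : prime p -> ~~ (p %| a) ->
  exists2 d, d %| p.-1 & forall m, (a ^ m == 1 %[mod p]) = (d %| m).
Proof.
move=> p_pr npa; have p1_gt0 : 0 < p.-1 by rewrite -ltnS prednK ?prime_gt0 ?prime_gt1.
have : ((a%:R : 'F_p) ^+ p.-1 = 1)%R.
  apply/eqP; rewrite eqF_natX // -totient_prime //; apply/eqP/Euler_exp_totient.
  by rewrite coprime_sym prime_coprime.
case/(prim_order_exists p1_gt0) => d prim_d dp; exists d => // m.
by rewrite -eqF_natX // -(prim_order_dvd prim_d).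
Qed.

Lemma primitive_root_mod_prime p : prime p ->
  exists g, forall m, (g ^ m == 1 %[mod p]) = (p.-1 %| m).
Proof.
move=> p_pr; have p1_gt0 : 0 < p.-1 by rewrite -ltnS prednK ?prime_gt0 ?prime_gt1.
pose rs := enum (predC1 (0 : 'F_p)%R).
have natF (x : 'F_p) : ((x : nat)%:R = x)%R by apply: natr_Zp.
have /hasP[z _ prim_z] : has (p.-1).-primitive_root%R rs.
  apply: has_prim_root => //; last by rewrite -cardE cardC1 card_Fp.
    apply/allP=> x; rewrite mem_enum inE => x_neq0; rewrite poly.unity_rootE -(natF x).
    rewrite eqF_natX // -totient_prime //; apply/eqP/Euler_exp_totient.
    by rewrite coprime_sym -unitFpE // natF GRing.unitfE.
  exact: enum_uniq.
by exists (z : nat) => m; rewrite -eqF_natX // natF -(prim_order_dvd prim_z).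
Qed.

(** If [d] divides [m] then [a ^ m] is a power of the principal base [a ^ d], and
    its congruences follow by lifting the exponent; otherwise [a ^ m] is not 1
    even modulo p. *)
Lemma same_congruences_odd_units p e d a b : prime p -> odd p ->
  ~~ (p %| a) -> ~~ (p %| b) ->
  (forall m, (a ^ m == 1 %[mod p]) = (d %| m)) ->
  (forall m, (b ^ m == 1 %[mod p]) = (d %| m)) ->
  (forall j, j <= e -> (a ^ d == 1 %[mod p ^ j]) = (b ^ d == 1 %[mod p ^ j])) ->
  same_congruences (p ^ e) a b.
Proof.
move=> p_pr p_odd npa npb ord_a ord_b eq_d.
have prE : principal_modulus p = p.
  by rewrite /principal_modulus; case: eqP p_odd => // ->.
apply: same_congruences_prime_power => // j le_j.
split=> [|m]; first by rewrite !dvdn_prime_power_coprime.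
have [/dvdnP[q ->] | nd] := boolP (d %| m).
  rewrite mulnC !expnM; apply: (eq_powers_of_principal p_pr _ _ eq_d) => //.
    by rewrite prE ord_a.
  by rewrite prE ord_b.
case: j {le_j} => [|j]; first by rewrite !modn1.
have neq1 c : (forall m, (c ^ m == 1 %[mod p]) = (d %| m)) ->
    (c ^ m == 1 %[mod p ^ j.+1]) = false.
  move=> ord_c; apply: contraNF nd; rewrite -ord_c; apply: eqn_mod_dvd_trans.
  by rewrite expnS dvdn_mulr.
by rewrite !neq1.
Qed.

Lemma coprime_dvd_pred p d : prime p -> d %| p.-1 -> coprime p d.
Proof.
move=> p_pr dp; have p1_gt0 : 0 < p.-1 by rewrite -ltnS prednK ?prime_gt0 ?prime_gt1.
rewrite prime_coprime // gtnNdvd ?(dvdn_gt0 p1_gt0 dp) //.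
by rewrite (leq_ltn_trans (dvdn_leq p1_gt0 dp)) // ltn_predL prime_gt0.
Qed.

(** Raising a primitive root modulo p to the power p^(e-1) gives an element of
    order p - 1 modulo [p ^ e], by Euler's theorem, with the same order modulo
    p; its powers provide every order [d] dividing p - 1. *)
Lemma root_of_unity_mod_prime_power p e : prime p -> 0 < e ->
  exists t : nat -> nat, forall d, d %| p.-1 ->
    t d ^ d == 1 %[mod p ^ e] /\ forall m, (t d ^ m == 1 %[mod p]) = (d %| m).
Proof.
move=> p_pr e_gt0; have [g gP] := primitive_root_mod_prime p_pr.
have p1_gt0 : 0 < p.-1 by rewrite -ltnS prednK ?prime_gt0 ?prime_gt1.
exists (fun d => g ^ (p.-1 %/ d * p ^ e.-1)) => d dp.
have d_gt0 := dvdn_gt0 p1_gt0 dp.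
have q_gt0 : 0 < p.-1 %/ d by rewrite divn_gt0 // dvdn_leq.
split=> [|m].
  rewrite -expnM mulnAC divnK // -totient_pfactor //; apply/eqP/Euler_exp_totient.
  rewrite coprime_prime_power //; apply/negP=> pg.
  have := gP p.-1; rewrite dvdnn -{2}(expn1 p) dvd_exp_eq1 //.
  by rewrite eqn0Ngt p1_gt0.
rewrite -expnM gP -{1}(divnK dp) -mulnA dvdn_pmul2l // Gauss_dvdr //.
by rewrite coprime_sym coprimeXl // coprime_dvd_pred.
Qed.

(** The representative for the order [d] and the level [w] is
    [t d * (1 + p ^ w)], with [t d] of order [d] both modulo p and modulo
    [p ^ e].  The [d]-th power of the representative is congruent to
    [(1 + p ^ w) ^ d] modulo [p ^ e], and so has level [w] because p does not
    divide [d]. *)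
Lemma unit_class_count_odd p e : prime p -> odd p -> 0 < e ->
  has_class_count (p ^ e) (fun a => coprime a (p ^ e)) (e * tau (p - 1)).
Proof.
move=> p_pr p_odd e_gt0; have p_gt1 := prime_gt1 p_pr; have p_gt0 := ltnW p_gt1.
have p1_gt0 : 0 < p.-1 by rewrite -ltnS prednK.
have [div_uniq _ div_mem] := divisors_correct p1_gt0.
have [t tP] := root_of_unity_mod_prime_power p_pr e_gt0.
pose Div := seq_sub (divisors p.-1).
have DivP (d : Div) : ssval d %| p.-1 by rewrite -div_mem ssvalP.
pose r (u : 'I_e * Div) := t (ssval u.2) * (1 + p ^ u.1.+1).
have r_ord u m : (r u ^ m == 1 %[mod p]) = (ssval u.2 %| m).
  have [_ <-] := tP _ (DivP u.2); rewrite expnMn -modnMmr -modnXm.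
  by rewrite expnS -modnDmr modnMr addn0 modnXm exp1n modnMmr muln1.
have r_lvl u j : j <= e -> (r u ^ ssval u.2 == 1 %[mod p ^ j]) = (j <= u.1.+1).
  move=> le_j; have [t1 _] := tP _ (DivP u.2).
  have {}t1 := eqn_mod_dvd_trans (dvdn_exp2l p le_j) t1.
  rewrite expnMn -modnMml (eqP t1) modnMml mul1n exp_eq1_coprime //.
  - by rewrite eqn_mod1_dvd // add1n /= dvdn_Pexp2l.
  - by rewrite expnS -modnDmr modnMr addn0.
  - exact: coprime_dvd_pred.
have r_unit u : ~~ (p %| r u).
  apply/negP=> pr; have := r_ord u p.-1.
  rewrite DivP -{2}(expn1 p) dvd_exp_eq1 // => /eqP p1_eq0.
  by rewrite p1_eq0 in p1_gt0.
exists ('I_e * Div)%type, r; split=> [|u|[i d] [i' d'] sim|a].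
- by rewrite card_prod card_ord card_seq_sub // /tau subn1.
- by rewrite coprime_prime_power.
- have eq_d : d = d'.
    apply/val_inj/eqP; rewrite eqn_dvd /=.
    have dv m : (ssval d %| m) = (ssval d' %| m).
      rewrite -(r_ord (i, d)) -(r_ord (i', d')).
      by have [|_ ->] := sim p; rewrite // -{1}(expn1 p) dvdn_exp2l.
    by apply/andP; split; [rewrite dv | rewrite -dv]; apply: dvdnn.
  congr (_, _) => //; apply/ord_inj/eqP; rewrite -eqSS; apply/eqP.
  apply: (@eq_of_eq_leq e) => // j le_j.
  rewrite -(r_lvl (i, d)) // -(r_lvl (i', d')) // -eq_d /=.
  by have [_ ->] := sim _ (dvdn_exp2l p le_j); rewrite eq_d.
rewrite coprime_prime_power // => npa; have [d dp ord_a] := order_mod_prime p_pr npa.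
have ad_gt0 : 0 < a ^ d by rewrite expn_gt0; case: a npa {ord_a} => //; rewrite dvdn0.
have [|[|w] [w_gt0 lt_w wP]] := @prime_power_level p e (a ^ d).-1 p_pr e_gt0 => //.
  by rewrite -eqn_mod1_dvd // ord_a.
have dDiv : d \in divisors p.-1 by rewrite div_mem.
exists (Ordinal lt_w, SeqSub dDiv).
apply: (@same_congruences_odd_units p e d) => // j le_j.
by rewrite (r_lvl (Ordinal lt_w, SeqSub dDiv)) // eqn_mod1_dvd // wP.
Qed.

(** * Powers of two *)

(** The representatives are 1 + 2^w for 2 <= w <= k and 2^w - 1 for
    2 <= w <= max (2, k - 1).  The range of the second family stops at k - 1 when
    k >= 3, because 2^(k-1) - 1 and 2^k - 1 both have square 1 modulo 2^k; for
    k = 2 the family is reduced to 3. *)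
Lemma unit_class_count_two_gt1 k : 1 < k ->
  has_class_count (2 ^ k) (fun a => coprime a (2 ^ k)) (k.-1 + maxn 1 (k - 2)).
Proof.
move=> k_gt1; have k_gt0 := ltnW k_gt1.
exists ('I_k.-1 + 'I_(maxn 1 (k - 2)))%type.
exists (fun u : 'I_k.-1 + 'I_(maxn 1 (k - 2)) =>
  match u with inl i => 1 + 2 ^ i.+2 | inr i => (2 ^ i.+2).-1 end).
have pow_gt0 i : 0 < 2 ^ i by rewrite expn_gt0.
have pow4 i : 2 ^ i.+2 = 4 * 2 ^ i by rewrite !expnS mulnA.
have dvd2 i j : (2 ^ i %| 2 ^ j) = (i <= j) by rewrite dvdn_Pexp2l.
have pr2 : prime 2 by [].
have d4 : 4 %| 2 ^ k by rewrite (dvd2 2).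
have one_mod4 i : 1 + 2 ^ i.+2 == 1 %[mod 4] by rewrite pow4 addnC mulnC modnMDl.
have three_mod4 i : (2 ^ i.+2).-1 == 3 %[mod 4].
  rewrite pow4 (_ : _.-1 = (2 ^ i).-1 * 4 + 3) ?modnMDl //.
  have := pow_gt0 i; lia.
have eq1_inl i j : (1 + 2 ^ i.+2 == 1 %[mod 2 ^ j]) = (j <= i.+2).
  by rewrite eqn_mod1_dvd // add1n /= dvd2.
(* a ^ 2 - 1 = (a - 1) (a + 1), where a - 1 is twice an odd number. *)
have sqr_three a j : a == 3 %[mod 4] -> (a ^ 2 == 1 %[mod 2 ^ j.+1]) = (2 ^ j %| a.+1).
  move=> a3; have /dvdnP[c Ec] : 4 %| a - 3.
    by rewrite -eqn_mod_dvd //; case: a a3 => [|[|[|]]].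
  have {Ec} -> : a = 4 * c + 3 by case: a a3 Ec => [|[|[|a]]] // _; lia.
  rewrite eqn_mod1_dvd ?expn_gt0 ?addn_gt0 ?orbT //.
  rewrite (_ : ((4 * c + 3) ^ 2).-1 = 2 * ((2 * c + 1) * (4 * c + 3).+1)); last by nia.
  rewrite expnS dvdn_pmul2l // Gauss_dvdr // coprimeXl // coprime2n; lia.
have not_one a : a == 3 %[mod 4] -> (a == 1 %[mod 4]) = false by move/eqP=> ->.
split=> [|u|[i|i] [i'|i'] sim|a].
- by rewrite card_sum !card_ord.
- rewrite coprime_prime_power // dvdn2 negbK; case: u => i.
    by rewrite pow4; lia.
  by have := pow_gt0 i; rewrite pow4; lia.
- congr inl; apply/ord_inj/eqP; rewrite -2!eqSS; apply/eqP.
  apply: (@eq_of_eq_leq k) => [||j le_j]; try (have := ltn_ord i; have := ltn_ord i'; lia).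
  have [_ /(_ 1)] := sim (2 ^ j) (dvdn_exp2l 2 le_j).
  by rewrite !expn1 !eq1_inl.
- by have [_ /(_ 1)] := sim 4 d4; rewrite !expn1 one_mod4 not_one.
- by have [_ /(_ 1)] := sim 4 d4; rewrite !expn1 one_mod4 not_one.
- congr inr; apply/ord_inj/eqP; rewrite -2!eqSS; apply/eqP.
  have lt_i := ltn_ord i; have lt_i' := ltn_ord i'.
  have [k2|k_gt2] := leqP k 2; first by lia.
  apply: (@eq_of_eq_leq k.-1) => [||j le_j]; try lia.
  have [|_ /(_ 2)] := sim (2 ^ j.+1); first by rewrite dvd2; lia.
  by rewrite !sqr_three // !prednK // !dvd2.
rewrite coprime_prime_power // => a_odd.
have a_gt0 : 0 < a by case: a a_odd.
have [a1 | a3] : a == 1 %[mod 4] \/ a == 3 %[mod 4].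
  move: a_odd; rewrite dvdn2 negbK; lia.
  have [|w [w_gt0 le_w wP]] := @prime_power_level 2 k a.-1 pr2 k_gt0.
    by move: a_odd; rewrite !dvdn2; lia.
  have w_gt1 : 1 < w by rewrite -wP // -eqn_mod1_dvd.
  have lt_w : w - 2 < k.-1 by lia.
  exists (inl (Ordinal lt_w)); rewrite /= (_ : (w - 2).+2 = w); last by lia.
  have Ew : w = (w - 2).+2 by lia.
  apply: same_congruences_prime_power => // j le_j; split=> [|m].
    rewrite !dvdn_prime_power_coprime //.
    by rewrite dvdn2 negbK Ew pow4; lia.
  apply: (@eq_powers_of_principal 2 k) => //; first by rewrite Ew.
  by move=> i le_i; rewrite Ew eq1_inl -Ew eqn_mod1_dvd ?wP.
have [|w [w_gt0 le_w wP]] := @prime_power_level 2 k a.+1 pr2 k_gt0.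
  by move: a_odd; rewrite !dvdn2 /=; lia.
have w_gt1 : 1 < w by rewrite -wP //; lia.
(* The level w of a + 1 is lowered from k to k - 1 if k > 2. *)
pose v := minn (w - 2) (maxn 1 (k - 2)).-1.
have lt_v : v < maxn 1 (k - 2) by rewrite /v; lia.
exists (inr (Ordinal lt_v)) => /=.
have b3 := three_mod4 v; set b := (2 ^ v.+2).-1 in b3 *.
have b_odd : ~~ (2 %| b) by rewrite dvdn2; lia.
have eq_sq j : j <= k -> (a ^ 2 == 1 %[mod 2 ^ j]) = (b ^ 2 == 1 %[mod 2 ^ j]).
  case: j => [|j] le_j; first by rewrite !modn1.
  by rewrite !sqr_three // (wP _ (ltnW le_j)) /b prednK // dvd2 /v; lia.
have eq_one c j : c == 3 %[mod 4] -> (c == 1 %[mod 2 ^ j]) = (j <= 1).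
  move=> c3; case: j => [|[|j]]; first by rewrite !modn1.
    by rewrite expn1; lia.
  apply: contraFF (not_one c c3); apply: eqn_mod_dvd_trans.
  by rewrite pow4 dvdn_mulr.
have sq_pr c : c == 3 %[mod 4] -> principal 2 (c ^ 2).
  by move=> /eqP c3; rewrite /principal_modulus /= -modnXm c3.
apply: same_congruences_prime_power => // j le_j; split=> [|m].
  by rewrite !dvdn_prime_power_coprime.
(* An odd power behaves like a itself, and an even one is a power of a ^ 2,
   which is 1 modulo 4. *)
have [m_odd | m_even] := boolP (odd m).
  have co_m : coprime 2 m by rewrite coprime2n.
  rewrite !exp_eq1_coprime // ?eq_one //.
    by move: b_odd; rewrite dvdn2; lia.
  by move: a_odd; rewrite dvdn2; lia.
rewrite (_ : m = 2 * m./2) ?expnM; last by rewrite mul2n even_halfK.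
by apply: (eq_powers_of_principal pr2 (sq_pr _ a3) (sq_pr _ b3) eq_sq).
Qed.

Lemma nilpotent_class_count_two k :
  has_class_count (2 ^ k) (fun a => exists m, 2 ^ k %| a ^ m) (maxn 1 k).
Proof.
case: k => [|k]; first exact: (has_class_count_one crt_nilpotent).
by rewrite (_ : maxn 1 k.+1 = k.+1); [apply: nilpotent_class_count | lia].
Qed.

Lemma unit_class_count_two k :
  has_class_count (2 ^ k) (fun a => coprime a (2 ^ k)) (maxn 1 (maxn k (2 * k - 3))).
Proof.
case: k => [|[|k]]; first exact: (has_class_count_one crt_coprime).
  exists unit, (fun=> 1); split=> [|//|[] []//|a]; first by rewrite card_unit.
  rewrite coprimen2 => a_odd; exists tt; apply: same_congruences_mod.
  by rewrite !modn2 a_odd.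
rewrite (_ : maxn 1 _ = k.+1 + maxn 1 (k.+2 - 2)); last by lia.
exact: (@unit_class_count_two_gt1 k.+2).
Qed.

Lemma total_class_count_two k :
  has_class_count (2 ^ k) (fun _ => True) (maxn (2 ^ (k * delta_le2 k)) (3 * k - 3)).
Proof.
case: k => [|k]; first exact: (has_class_count_one crt_true).
rewrite (_ : maxn _ _ = maxn 1 k.+1 + maxn 1 (maxn k.+1 (2 * k.+1 - 3))).
  apply: total_class_count => //; first exact: nilpotent_class_count_two.
  exact: unit_class_count_two.
(* The maximum is 2 and 4 for the exponents 1 and 2, and k + (2 k - 3) for
   an exponent k > 2. *)
case: k => [|[|k]] //; rewrite /delta_le2 /= muln0 expn0; lia.
Qed.

(** * The count for a general modulus *)

(** The power of 2 is kept apart because its exponent may be 0 and its class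
    counts follow another formula. *)
Lemma has_class_count_factored P k l (p e : 'I_l -> nat) N0 (N : 'I_l -> nat) :
  crt_property P ->
  (forall i, prime (p i)) -> (forall i, odd (p i)) -> injective p ->
  has_class_count (2 ^ k) (P (2 ^ k)) N0 ->
  (forall i, has_class_count (p i ^ e i) (P (p i ^ e i)) (N i)) ->
  has_class_count (2 ^ k * \prod_(i < l) p i ^ e i)
    (P (2 ^ k * \prod_(i < l) p i ^ e i)) (N0 * \prod_(i < l) N i).
Proof.
move=> crtP p_pr p_odd p_inj cnt2 cntp.
apply: has_class_count_mul => //; first by rewrite expn_gt0.
  rewrite coprimeXl //; elim/big_ind: _ => [|m1 m2 co1 co2|i _]; first exact: coprimen1.
    by rewrite coprimeMr co1.
  by rewrite coprimeXr // coprime2n.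
apply: has_class_count_prod => // [|i|i j neq_ij].
- exact: index_enum_uniq.
- by rewrite expn_gt0 prime_gt0.
rewrite coprimeXl // coprimeXr // prime_coprime // dvdn_prime2 //.
by rewrite (inj_eq p_inj).
Qed.

(* The truncated differences 3 * k - 3 and 2 * k - 3 differ from the integer
   ones only where the latter are negative, and then the other argument of
   maxn is at least 1 and decides the maximum. *)
Theorem theorem8 (n k l : nat) (p e : 'I_l -> nat)
  (p_prime : forall i, prime (p i)) (p_odd : forall i, odd (p i))
  (p_inj : injective p) (e_gt0 : forall i, 1 <= e i)
  (n_def : n = 2 ^ k * \prod_(i < l) p i ^ e i) :
  [/\ #|isotypes (state_spaces (Zmod n))|
        = maxn (2 ^ (k * delta_le2 k)) (3 * k - 3)
          * \prod_(i < l) (e i * (tau (p i - 1) + 1)),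
      #|isotypes (one_trees (Zmod n))| = maxn 1 k * \prod_(i < l) e i
    & #|isotypes (cycle_unions (Zmod n))|
        = maxn 1 (maxn k (2 * k - 3))
          * \prod_(i < l) (e i * tau (p i - 1))].
Proof.
have total := has_class_count_factored crt_true p_prime p_odd p_inj
  (total_class_count_two k) (fun i => total_class_count (p_prime i) (e_gt0 i)
    (nilpotent_class_count (p_prime i) (e_gt0 i))
    (unit_class_count_odd (p_prime i) (p_odd i) (e_gt0 i))).
have trees := has_class_count_factored crt_nilpotent p_prime p_odd p_inj
  (nilpotent_class_count_two k) (fun i => nilpotent_class_count (p_prime i) (e_gt0 i)).
have cycles := has_class_count_factored crt_coprime p_prime p_odd p_inj
  (unit_class_count_two k)
  (fun i => unit_class_count_odd (p_prime i) (p_odd i) (e_gt0 i)).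
have n_gt0 : 0 < n.
  by rewrite n_def muln_gt0 expn_gt0 prodn_gt0 // => i; rewrite expn_gt0 prime_gt0.
rewrite -{}n_def in total trees cycles; case: n n_gt0 => // n _ in total trees cycles *.
split.
- rewrite (eq_bigr (fun i => e i + e i * tau (p i - 1))).
    apply: card_isotypes total => D; split=> [/state_spacesP[a ->] | [a [_ ->]]].
      by exists a.
    by apply/state_spacesP; exists a.
  by move=> i _; rewrite mulnDr muln1 addnC.
- apply: card_isotypes trees => D; rewrite inE; split.
    case/andP=> /state_spacesP[a ->] /weakly_connected_multiplication nil_a.
    by exists a.
  case=> a [nil_a ->]; apply/andP; split; first by apply/state_spacesP; exists a.
  exact/weakly_connected_multiplication.
apply: card_isotypes cycles => D; rewrite inE; split.
  case/andP=> /state_spacesP[a ->] /cycle_unions_multiplication co_a.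
  by exists a.
case=> a [co_a ->]; apply/andP; split; first by apply/state_spacesP; exists a.
exact/cycle_unions_multiplication.
Qed.
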